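(* Let $\mathbf E=(E,+,{}',0,1)$ be an effect algebra, $M\subseteq E$, and let $\mathrm{Ded}(\mathbf E)$ be the set of all deductive systems of $\mathbf E$. Then: (i) $(\mathrm{Ded}(\mathbf E),\subseteq)$ is a complete lattice with smallest element $\{1\}$ and greatest element $E$; (ii) if there exists some $x\in E\setminus\{0,1\}$ with $x'\neq x$, then $(\mathrm{Ded}(\mathbf E),\subseteq)$ is atomic and its atoms are exactly the sets $\{1,x\}$ with $x\in E\setminus\{0,1\}$ and $x'\neq x$; (iii) the deductive system of $\mathbf E$ generated by $M$ (the smallest deductive system containing $M$) equals $M\cup\{1\}$ if both $M\cap M'=\emptyset$ and $0\notin M$, and equals $E$ otherwise.
   Context: An effect algebra is a partial algebra $(E,+,{}',0,1)$ of type $(2,1,0,0)$ where $+$ is a partial binary operation such that for all $x,y,z\in E$: (E1) $x+y$ is defined iff $y+x$ is defined, and then $x+y=y+x$; (E2) $(x+y)+z$ is defined iff $x+(y+z)$ is defined, and then they are equal; (E3) $x'$ is the unique $u\in E$ with $x+u=1$; (E4) if $1+x$ is defined then $x=0$. The induced order is $x\leq y$ iff $x+z=y$ for some $z$; $x+y$ is defined iff $x\leq y'$. $L(x,y)$ is the set of common lower bounds of $x,y$, and the implication is the subset $x\rightarrow y:=x'+L(x,y)=\{x'+u\mid u\in L(x,y)\}$. For $M\subseteq E$, $M'=\{m'\mid m\in M\}$. A subset $D\subseteq E$ is a deductive system of $\mathbf E$ if $1\in D$ and, for all $x,y\in E$, $x\in D$ and $x\rightarrow y\subseteq D$ imply $y\in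 D$. *)

(* Defs.v *)
From HB Require Import structures.
From mathcomp Require Import all_boot all_order.
From mathcomp Require Import boolp classical_sets.

Set Implicit Arguments.
Unset Strict Implicit.
Unset Printing Implicit Defensive.

Local Open Scope classical_set_scope.

(* The partial sum is option-valued: [eadd x y = None] means that x + y is
   undefined, so an equation between options also says that one side is
   defined iff the other one is. *)
Record effectAlgebra := EffectAlgebra {
  ecarrier :> Type;
  eadd : ecarrier -> ecarrier -> option ecarrier;
  ecompl : ecarrier -> ecarrier;
  ezero : ecarrier;
  eone : ecarrier;
  eaddC : forall x y, eadd x y = eadd y x;
  eaddA : forall x y z,
    obind (fun s => eadd s z) (eadd x y) = obind (fun t => eadd x t) (eadd y z);
  ecomplP : forall x u, eadd x u = Some eone <-> u = ecompl x;
  eadd1 : forall x, eadd eone x <> None -> x = ezero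
}.

Arguments ezero {_}.
Arguments eone {_}.

Section EffectAlgebraTheory.
Variable E : effectAlgebra.
Implicit Types (x y z u w : E) (M D : set E).

Definition ele x y := exists z, eadd x z = Some y.

Definition common_lb x y : set E := [set u | ele u x /\ ele u y].

(* x' + u is defined for every u in L(x,y), because u <= x. *)
Definition impl x y : set E :=
  [set w | exists2 u, common_lb x y u & eadd (ecompl x) u = Some w].

Definition deductive_system D :=
  D eone /\ forall x y, D x -> impl x y `<=` D -> D y.

(* The order inherited by this subtype of [set E] is inclusion. *)
Record Ded := MkDed { ded_set :> set E; _ : `[< deductive_system ded_set >] }.

HB.instance Definition _ := [isSub for ded_set].
HB.instance Definition _ := [Choice of Ded by <:].
HB.instance Definition _ :=
  [SubChoice_isSubPOrder of Ded by <: with set_display].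

Definition generated M D :=
  [/\ deductive_system D, M `<=` D &
      forall D', deductive_system D' -> M `<=` D' -> D `<=` D'].

End EffectAlgebraTheory.

Section OrderNotions.
Context {d : Order.disp_t} {L : porderType d}.
Implicit Types (x a b : L).

Definition least x := forall y, (x <= y)%O.

Definition greatest x := forall y, (y <= x)%O.

Definition atom a :=
  ~ least a /\ forall b, (b <= a)%O -> least b \/ b = a.

End OrderNotions.

Definition complete_lattice {d : Order.disp_t} (L : porderType d) :=
  forall S : set L, supremums S !=set0 /\ infimums S !=set0.

Definition atomic {d : Order.disp_t} (L : porderType d) :=
  forall x : L, ~ least x -> exists2 a : L, atom a & (a <= x)%O.

(* Main.v *)
(* A deductive system D containing some x together with x' is everything:
   x -> 0 = {x'} puts 0 into D, and 0 -> y = {1} then puts every y into D.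
   Conversely, since 0 is a common lower bound of x and y, the set x -> y always
   contains x'; so a set containing 1 in which x and x' never occur together
   satisfies the closure condition vacuously.  The proper deductive systems are
   therefore exactly the sets D with 1 in D and D disjoint from D'. *)

Require Import Defs.
From HB Require Import structures.
From mathcomp Require Import all_boot all_order.
From mathcomp Require Import boolp classical_sets.

Local Open Scope classical_set_scope.

Section EffectAlgebra.
Context {E : effectAlgebra}.
Implicit Types (x y u : E) (M D : set E).

Lemma eaddx' x : eadd x (ecompl x) = Some eone.
Proof. exact/ecomplP. Qed.

Lemma ecompl1 : ecompl eone = ezero :> E.
Proof. by apply: eadd1; rewrite eaddx'. Qed.

Lemma ecomplK : involutive (@ecompl E).
Proof. by move=> x; symmetry; apply/ecomplP; rewrite eaddC eaddx'. Qed.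

Lemma ecompl0 : ecompl ezero = eone :> E.
Proof. by rewrite -ecompl1 ecomplK. Qed.

(** Associativity on x', x, 0: the sum (x' + x) + 0 = 1 + 1' equals 1, so x + 0 is defined and its
    sum with x' is 1; hence it is x'' = x. *)
Lemma eaddx0 x : eadd x ezero = Some x.
Proof.
have := eaddA (ecompl x) x ezero.
rewrite [eadd _ x]eaddC eaddx' /= -{1}ecompl1 eaddx'.
case: (eadd x ezero) => [t|] //= /esym/ecomplP ->.
by rewrite ecomplK.
Qed.

Lemma ele0x x : ele ezero x.
Proof. by exists x; rewrite eaddC eaddx0. Qed.

(** If u + z = 0, then 1 + (u + z) = 1 is defined, hence so is 1 + u by associativity, and this
    forces u = 0. *)
Lemma elex0 u : ele u ezero -> u = ezero.
Proof.
move=> [z uz0]; apply: eadd1 => u1.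
by have := eaddA eone u z; rewrite uz0 u1 /= eaddx0.
Qed.

Lemma impl_compl x y : impl x y (ecompl x).
Proof.
by exists ezero; [split; apply: ele0x | rewrite eaddx0].
Qed.

Lemma impl0x y : impl ezero y `<=` [set eone].
Proof. by move=> w [u [/elex0-> _]]; rewrite eaddx0 ecompl0 => -[<-]. Qed.

Lemma implx0 x : impl x ezero `<=` [set ecompl x].
Proof. by move=> w [u [_ /elex0->]]; rewrite eaddx0 => -[<-]. Qed.

Lemma deductive_system0 D : deductive_system D -> D ezero -> D = setT.
Proof.
move=> [D1 Dmp] D0; apply/seteqP; split=> // y _.
by apply: (Dmp _ y D0) => w /impl0x ->.
Qed.

Lemma deductive_system_compl D x :
  deductive_system D -> D x -> D (ecompl x) -> D = setT.
Proof.
move=> dD Dx Dx'; apply: (deductive_system0 _ dD).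
by apply: (dD.2 _ _ Dx) => w /implx0 ->.
Qed.

Lemma deductive_system_disjoint D :
  D eone -> (forall x, D x -> ~ D (ecompl x)) -> deductive_system D.
Proof.
move=> D1 Dx'; split=> // x y Dx sub.
by case: (Dx' x Dx); apply/sub/impl_compl.
Qed.

Lemma deductive_systemT : deductive_system [set: E].
Proof. by []. Qed.

Lemma deductive_system_bigcap (S : set (set E)) :
  S `<=` @deductive_system E -> deductive_system (\bigcap_(D in S) D).
Proof.
move=> Sd; split=> [D /Sd[]//|x y Sx Sxy D SD].
by apply: ((Sd _ SD).2 x) => [|w /Sxy Sw]; [exact: Sx | exact: Sw].
Qed.

(** When 0 and 1 differ, M with 1 added contains no x together with x': both in M contradicts
    disjointness, one in M and the other equal to 1 puts 0 = 1' into M, and x = x' = 1 gives 0 =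
    1. *)
Lemma deductive_systemU1 M :
  M `&` (@ecompl E @` M) = set0 -> ~ M ezero ->
  deductive_system (M `|` [set eone]).
Proof.
(* If 0 = 1, the pair 1, 1' = 1 defeats the disjointness criterion; but then 1 + x = 0 + x is always
   defined, so E has one element and the set is all of E. *)
move=> MM' M0; have [E01|E01] := pselect (ezero = eone :> E).
  suff -> : M `|` [set eone] = setT by exact: deductive_systemT.
  apply/seteqP; split=> // x _; right => /=; rewrite -E01.
  by apply: eadd1; rewrite -E01 eaddC eaddx0.
apply: deductive_system_disjoint => [|x]; first by right.
move=> [Mx|->] [Mx'|x'1].
- suff: (M `&` (@ecompl E @` M)) (ecompl x) by rewrite MM'.
  by split=> //; exists x.
- by apply: M0; rewrite -ecompl1 -x'1 ecomplK.
- by apply: M0; rewrite -ecompl1.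
- by apply: E01; rewrite -ecompl1.
Qed.

Lemma deductive_system1 : deductive_system [set (eone : E)].
Proof.
by rewrite -[X in deductive_system X]set0U; apply: deductive_systemU1;
  rewrite ?set0I.
Qed.

Lemma deductive_system_pair x :
  x <> ezero -> ecompl x <> x -> deductive_system [set eone; x].
Proof.
move=> x0 x'x; rewrite setUC; apply: deductive_systemU1 => [|/esym//].
by rewrite image_set1; apply/seteqP; split=> // y /= [-> /esym].
Qed.

Lemma dedP (A : Ded E) : deductive_system A.
Proof. by case: A => D /= /asboolP. Qed.

Definition ded D (dD : deductive_system D) : Ded E := MkDed (asboolT dD).

Lemma ded_set_inj : injective (@ded_set E).
Proof. exact: val_inj. Qed.

Lemma leDed (A B : Ded E) : (A <= B)%O <-> ded_set A `<=` ded_set B.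
Proof. by rewrite -[(A <= B)%O]/(ded_set A <= ded_set B)%O subsetEset. Qed.

Lemma least_dedP (A : Ded E) : least A <-> ded_set A = [set eone].
Proof.
split=> [/(_ (ded _ deductive_system1))/leDed sA|A1 B].
  by apply/seteqP; split=> // _ ->; exact: (dedP A).1.
by apply/leDed; rewrite A1 => _ ->; exact: (dedP B).1.
Qed.

Lemma Ded_infimum (S : set (Ded E)) : infimums S !=set0.
Proof.
have SP : [set ded_set A | A in S] `<=` @deductive_system E.
  by move=> _ [A _ <-]; exact: dedP.
(* The infimum is the intersection, which is E when [S] is empty. *)
exists (ded _ (deductive_system_bigcap _ SP)); split=> [A SA|B lbB].
  by apply/leDed => x; apply; exists A.
by apply/leDed => x Bx _ [A SA <-]; move/leDed: (lbB A SA); apply.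
Qed.

(** A supremum is obtained as the infimum of the set of upper bounds. *)
Lemma Ded_complete_lattice : complete_lattice (Ded E).
Proof.
move=> S; split; last exact: Ded_infimum.
have [A [lbA glbA]] := Ded_infimum (ubound S).
by exists A; split=> [B SB|B ubB]; [apply: glbA => C; apply | exact: lbA].
Qed.

Lemma atom_pair (A : Ded E) x :
  x <> eone -> ded_set A = [set eone; x] -> atom A.
Proof.
move=> x1 Ax; split=> [/least_dedP A1|B /leDed sBA].
  have : ded_set A x by rewrite Ax; right.
  by rewrite A1.
have [Bx|Bx] := pselect (ded_set B x); [right|left].
  apply/ded_set_inj/seteqP; split=> //.
  by rewrite Ax => _ [->|->] //; exact: (dedP B).1.
apply/least_dedP/seteqP; split=> [y By|_ ->]; last exact: (dedP B).1.
by move: (sBA y By); rewrite Ax => -[//|yx]; rewrite yx in By.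
Qed.

(** If A is proper, any y in A other than 1 serves: y = 0 or y' = y would make A all of E. If A is
    E, the x given by the hypothesis serves. *)
Lemma pair_sub_ded (A : Ded E) :
  (exists x : E, [/\ x <> ezero, x <> eone & ecompl x <> x]) -> ~ least A ->
  exists2 x : E, [/\ x <> ezero, x <> eone & ecompl x <> x] &
    [set eone; x] `<=` ded_set A.
Proof.
move=> [x xP] nA; have [AT|AT] := pselect (ded_set A = setT).
  by exists x; rewrite // AT.
have [y Ay y1] : exists2 y, ded_set A y & y <> eone.
  apply: contrapT => nex; apply/nA/least_dedP/seteqP.
  split=> [y Ay|_ ->]; last exact: (dedP A).1.
  by apply: contrapT => y1; apply: nex; exists y.
exists y => [|_ [->|->] //]; last exact: (dedP A).1.
split=> // [y0|y'y]; apply: AT.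
  by apply: deductive_system0 (dedP A) _; rewrite -y0.
by apply: (deductive_system_compl _ y (dedP A)); rewrite ?y'y.
Qed.

(** Gives atomicity at once; applied to an atom [A], it also shows that [A] is itself such a
    pair. *)
Lemma atom_sub_ded (A : Ded E) :
  (exists x : E, [/\ x <> ezero, x <> eone & ecompl x <> x]) -> ~ least A ->
  exists2 x : E, [/\ x <> ezero, x <> eone & ecompl x <> x] &
    exists B : Ded E, [/\ ded_set B = [set eone; x], atom B & (B <= A)%O].
Proof.
move=> exx nA; have [x [x0 x1 x'x] sxA] := pair_sub_ded A exx nA.
exists x => //; exists (ded _ (deductive_system_pair x x0 x'x)).
by split=> //; [exact: (atom_pair _ x) | exact/leDed].
Qed.

(** By contraposition: a proper deductive system containing M keeps 0 out of M and M disjoint from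
    M'. *)
Lemma generatedT M :
  ~ (M `&` (@ecompl E @` M) = set0 /\ ~ M ezero) -> generated M setT.
Proof.
move=> nM; split=> [||D dD sMD]; [exact: deductive_systemT | by [] |].
suff -> : D = setT by [].
apply: contrapT => DT; apply: nM; split=> [|/sMD D0]; last first.
  exact/DT/deductive_system0.
apply/seteqP; split=> // y [Mx' [x Mx xy]]; apply: DT.
by apply: (deductive_system_compl _ x dD (sMD _ Mx)); rewrite xy; apply: sMD.
Qed.

End EffectAlgebra.

Theorem theorem13 (E : effectAlgebra) (M : set E) :
  [/\ [/\ complete_lattice (Ded E),
          exists2 D : Ded E, ded_set D = [set eone] & least D
        & exists2 D : Ded E, ded_set D = setT & greatest D],
      (exists x : E, [/\ x <> ezero, x <> eone & ecompl x <> x]) ->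
        atomic (Ded E) /\
        [set ded_set A | A in [set A : Ded E | atom A]] =
        [set [set eone; x] | x in
           [set x : E | [/\ x <> ezero, x <> eone & ecompl x <> x]]]
    & (M `&` (@ecompl E @` M) = set0 /\ ~ M ezero ->
         generated M (M `|` [set eone])) /\
      (~ (M `&` (@ecompl E @` M) = set0 /\ ~ M ezero) ->
         generated M setT)].
Proof.
split; [split | | split].
- exact: Ded_complete_lattice.
- by exists (ded _ deductive_system1) => //; exact/least_dedP.
- by exists (ded _ deductive_systemT) => // A; apply/leDed.
- move=> exx; split=> [A /(atom_sub_ded A exx)[x _ [B [_ aB BA]]]|].
    by exists B.
  apply/seteqP; split=> [_ [A [nA minA] <-]|_ [x [x0 x1 x'x] <-]].
    have [x xP [B [Bx [nB _] BA]]] := atom_sub_ded A exx nA.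
    (* As [A] is an atom, [B] is least or equal to [A]; being an atom, [B] is not least. *)
    by exists x => //; case: (minA B BA) => [//|<-].
  exists (ded _ (deductive_system_pair x x0 x'x)) => //.
  exact: (atom_pair _ x).
- move=> [MM' M0]; split; [exact: deductive_systemU1 | exact: subsetUl |].
  by move=> D dD sMD _ [/sMD //|->]; exact: dD.1.
- exact: generatedT.
Qed.
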